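(* For every classical topological space $X$, the following are equivalent: (i) $X$ is exponentiable in $\mathbf{Top}$; (ii) $X$ is core-compact, equivalently, $\mathcal{O}X$ is a continuous lattice; (iii) the induced fuzzy space $\omega X$ satisfies stratified Scott–core approximation (SKA); (iv) $\omega X$ is exponentiable in $\mathbf{LFTS}$.
   Context: Let $\mathbb{I}=[0,1]$ with its usual order; $\underline{a}$ denotes the constant map with value $a\in\mathbb{I}$; joins $\bigvee$, meets $\wedge$ and the order $\le$ of $\mathbb{I}$-valued maps are pointwise. A (stratified) Lowen fuzzy topology on a set $S$ is a subset $\tau_S\subseteq\mathbb{I}^S$ containing all constant maps and closed under arbitrary pointwise joins and finite pointwise meets; $(S,\tau_S)$ is a Lowen fuzzy topological space, and members of $\tau_S$ are called fuzzy open. A map $f:S\to T$ is continuous if $v\circ f\in\tau_S$ for all $v\in\tau_T$. $\mathbf{LFTS}$ is the category of all Lowen fuzzy topological spaces and continuous maps; finite products carry the least Lowen topology containing all composites of fuzzy opens of the factors with the projections. $\mathbf{Top}$ is the category of topological spaces and continuous maps. An object $A$ of a category with finite products is exponentiable if the functor $-\times A$ has a right adjoint. For a topological space $X$, $\mathcal{O}X$ is its lattice of open sets, ordered by inclusion, with way-below relation $\ll$; $X$ is core-compact if for every open $V$ and $x\in V$ there is an open $U$ with $x\in U\ll V$. The induced space is $\omega X=(X,\omega(\mathcal{O}X))$ with $\omega(\mathcal{O}X)=\{u:X\to\mathbb{I}: u\text{ is lower semicontinuous}\}$, i.e. $\{x:u(x)>t\}\in\mathcal{O}X$ for all $t\in\mathbb{I}$;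 this is a Lowen fuzzy topology. $\mathbb{S}=(\mathbb{I},\delta_{\mathbb{S}})$, where $\delta_{\mathbb{S}}$ is the least Lowen topology on $\mathbb{I}$ containing $\mathrm{id}_{\mathbb{I}}$. For a Lowen space $(S,\tau_S)$, a map $\Phi:\tau_S\to\mathbb{I}$ is Scott-continuous if it is monotone and $\Phi(\bigvee D)=\bigvee_{\mu\in D}\Phi(\mu)$ for every nonempty directed $D\subseteq\tau_S$; it satisfies finite-tier compatibility (FTC) if for every $n\ge1$ and $\beta_1,\dots,\beta_n\in\tau_S$ the map $(r_1,\dots,r_n)\mapsto\Phi\bigl(\bigvee_{i=1}^n(\underline{r_i}\wedge\beta_i)\bigr)$ is fuzzy open in the product $\mathbb{S}^n$. $\Sigma_S$ is the set of all Scott-continuous $\Phi:\tau_S\to\mathbb{I}$ satisfying FTC. For $\lambda\in\tau_S$, $\Phi\in\Sigma_S$, $\lambda\triangleleft\Phi$ means $\underline{\Phi(\nu)}\wedge\lambda\le\nu$ for all $\nu\in\tau_S$. The space $S$ satisfies SKA if $\mu=\bigvee_{\Phi\in\Sigma_S,\,\lambda\in\tau_S,\,\lambda\triangleleft\Phi}(\underline{\Phi(\mu)}\wedge\lambda)$ for every $\mu\in\tau_S$. *)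

(* Defs.v *)
From HB Require Import structures.
From mathcomp Require Import all_boot all_order all_algebra.
From mathcomp Require Import all_classical all_reals interval_inference topology.

Set Implicit Arguments.
Unset Strict Implicit.
Unset Printing Implicit Defensive.

Import Order.TTheory GRing.Theory Num.Theory.

Local Open Scope classical_set_scope.
Local Open Scope ring_scope.

Record category := Category {
  cat_obj :> Type;
  cat_hom : cat_obj -> cat_obj -> Type;
  cat_id : forall a, cat_hom a a;
  cat_comp : forall a b c, cat_hom b c -> cat_hom a b -> cat_hom a c;
  cat_compidl : forall a b (f : cat_hom a b), cat_comp (cat_id b) f = f;
  cat_compidr : forall a b (f : cat_hom a b), cat_comp f (cat_id a) = f;
  cat_compA : forall a b c d (h : cat_hom c d) (g : cat_hom b c) (f : cat_hom a b),
    cat_comp h (cat_comp g f) = cat_comp (cat_comp h g) f }.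

Arguments cat_hom {_} _ _.
Arguments cat_id {_} _.
Arguments cat_comp {_ _ _ _} _ _.

Local Notation "g ∘ f" := (cat_comp g f) (at level 40, left associativity).

Record functor (C D : category) := Functor {
  functor_obj :> C -> D;
  functor_map : forall a b, cat_hom a b -> cat_hom (functor_obj a) (functor_obj b);
  functor_map_id : forall a, functor_map (cat_id a) = cat_id (functor_obj a);
  functor_map_comp : forall a b c (g : cat_hom b c) (f : cat_hom a b),
    functor_map (g ∘ f) = functor_map g ∘ functor_map f }.

Arguments functor_map {C D} _ {a b} _.

Definition left_adjoint (C D : category) (F : functor C D) (G : functor D C) :=
  exists phi : forall (c : C) (d : D), cat_hom (F c) d -> cat_hom c (G d),
    [/\ forall c d, bijective (phi c d),
        forall c c' d (f : cat_hom c' c) (h : cat_hom (F c) d),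
          phi c' d (h ∘ functor_map F f) = phi c d h ∘ f
      & forall c d d' (g : cat_hom d d') (h : cat_hom (F c) d),
          phi c d' (g ∘ h) = functor_map G g ∘ phi c d h].

Definition has_right_adjoint (C D : category) (F : functor C D) :=
  exists G : functor D C, left_adjoint F G.

Record finite_products (C : category) := FiniteProducts {
  terminal : C;
  to_terminal : forall a : C, cat_hom a terminal;
  to_terminal_uniq : forall (a : C) (f : cat_hom a terminal), f = to_terminal a;
  prod_obj : C -> C -> C;
  prod_proj1 : forall a b, cat_hom (prod_obj a b) a;
  prod_proj2 : forall a b, cat_hom (prod_obj a b) b;
  prod_pair : forall c a b, cat_hom c a -> cat_hom c b -> cat_hom c (prod_obj a b);
  prod_pair1 : forall c a b (f : cat_hom c a) (g : cat_hom c b),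
    prod_proj1 a b ∘ prod_pair f g = f;
  prod_pair2 : forall c a b (f : cat_hom c a) (g : cat_hom c b),
    prod_proj2 a b ∘ prod_pair f g = g;
  prod_pair_uniq : forall c a b (h : cat_hom c (prod_obj a b)),
    h = prod_pair (prod_proj1 a b ∘ h) (prod_proj2 a b ∘ h) }.

Section Exponentiable.
Variables (C : category) (P : finite_products C) (A : C).

Definition times_map (a b : C) (f : cat_hom a b) :
    cat_hom (prod_obj P a A) (prod_obj P b A) :=
  prod_pair P (f ∘ prod_proj1 P a A) (prod_proj2 P a A).

Lemma times_map_id a : times_map (cat_id a) = cat_id (prod_obj P a A).
Proof.
by rewrite [RHS]prod_pair_uniq !cat_compidr /times_map cat_compidl.
Qed.

Lemma times_map_comp a b c (g : cat_hom b c) (f : cat_hom a b) :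
  times_map (g ∘ f) = times_map g ∘ times_map f.
Proof.
rewrite [RHS]prod_pair_uniq; congr prod_pair; rewrite cat_compA /times_map.
  by rewrite prod_pair1 -!cat_compA prod_pair1.
by rewrite prod_pair2 prod_pair2.
Qed.

Definition times_functor : functor C C := Functor times_map_id times_map_comp.

Definition exponentiable := has_right_adjoint times_functor.

End Exponentiable.

Section Top.
Implicit Types X Y Z : topologicalType.

HB.instance Definition _ := @isOpenTopological.Build unit setT
  I (fun _ _ _ _ => I) (fun _ _ _ => I).

Lemma fst_continuous X Y : continuous (@fst X Y).
Proof. by move=> p; exact: cvg_fst. Qed.

Lemma snd_continuous X Y : continuous (@snd X Y).
Proof. by move=> p; exact: cvg_snd. Qed.

Lemma pair_continuous Z X Y (f : continuousType Z X) (g : continuousType Z Y) :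
  continuous (fun z => (f z, g z)).
Proof. by move=> z; apply: cvg_pair => //; exact: cts_fun. Qed.

(* The choice structure carried by a [topologicalType] is no restriction: by
   classical choice every type has one, and continuous maps ignore it. *)
Definition Top : category.
Proof.
refine (@Category topologicalType (fun X Y => continuousType X Y)
  (fun X => @idfun X : continuousType X X)
  (fun X Y Z g f => g \o f : continuousType X Z) _ _ _).
- by move=> X Y f; apply/continuousEP.
- by move=> X Y f; apply/continuousEP.
- by move=> X Y Z W h g f; apply/continuousEP.
Defined.

Definition Top_products : finite_products Top.
Proof.
refine (@FiniteProducts Top (unit : topologicalType)
  (fun X => cst tt : continuousType X unit) _
  (fun X Y => (X * Y)%type : topologicalType)
  (fun X Y => mkcts (@fst_continuous X Y) : continuousType _ _)
  (fun X Y => mkcts (@snd_continuous X Y) : continuousType _ _)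
  (fun Z X Y f g => mkcts (@pair_continuous Z X Y f g) : continuousType _ _) _ _ _).
- by move=> X f; apply: (continuousEP _ _).2 => x; case: (f x).
- by move=> Z X Y f g; apply: (continuousEP _ _).2.
- by move=> Z X Y f g; apply: (continuousEP _ _).2.
- by move=> Z X Y h; apply: (continuousEP _ _).2 => z /=; exact: surjective_pairing.
Defined.

End Top.

HB.instance Definition _ d (T : porderType d) (A : set T) : Order.POrder d (set_type A) :=
  [POrder of set_type A by <:].

Section WayBelow.
Variables (d : Order.disp_t) (L : porderType d).

Definition directed (D : set L) :=
  D !=set0 /\ forall a b, D a -> D b -> exists c, [/\ D c, a <= c & b <= c]%O.

Definition way_below (a b : L) := forall (D : set L) (s : L),
  directed D -> supremums D s -> (b <= s)%O -> exists2 c, D c & (a <= c)%O.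

Definition complete_lattice := forall A : set L, exists s, supremums A s.

Definition continuous_lattice :=
  complete_lattice /\ forall a : L, supremums [set b | way_below b a] a.

End WayBelow.

(* [<=] on [opens X] is the inclusion inherited from [set X] *)
Definition opens (X : topologicalType) := set_type (@open X).

Definition core_compact (X : topologicalType) :=
  forall (V : opens X) (x : X), val V x ->
    exists2 U : opens X, val U x & way_below U V.

Section Lowen.
Variable R : realType.
Local Notation I := {i01 R}.

(* the join of the complete lattice [0, 1]; the empty join is 0 *)
Definition isup (A : set I) : I := supremum 0%:i01 A.

Lemma isupP (A : set I) : supremums A (isup A).
Proof.
rewrite /isup /supremum; case: eqP => [->|/eqP/set0P[a0 Aa0]].
  by split=> // y _; rewrite -num_le/= ge0.
apply: xgetPex; pose B : set R := [set a%:num | a in A].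
have B1 : ubound B 1 by move=> _ [a _ <-]; exact: le1.
have Bub : has_ubound B by exists 1.
have s0 : 0 <= sup B.
  by apply: (le_trans (ge0 a0)); apply: ub_le_sup => //; exists a0.
have s1 : sup B <= 1 by apply: ge_sup B1; exists a0%:num; exists a0.
exists (Itv01 s0 s1); split=> [a Aa|y Ay]; rewrite -num_le/=.
  by apply: ub_le_sup => //; exists a.
apply: ge_sup; first by exists a0%:num; exists a0.
by move=> _ [a Aa <-]; rewrite num_le; exact: Ay.
Qed.

Lemma lt_isup (A : set I) t : (t < isup A)%O <-> exists2 a, A a & (t < a)%O.
Proof.
have [ub lub] := isupP A; split=> [tA|[a Aa ta]]; last exact: lt_le_trans (ub _ Aa).
apply: contrapT => nA; move: tA; rewrite ltNge => /negP; apply; apply: lub => a Aa.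
by rewrite leNgt; apply/negP => ta; apply: nA; exists a.
Qed.

Definition pjoin (S : Type) (F : set (S -> I)) : S -> I :=
  fun x => isup [set u x | u in F].

(* [(u `&` v)%O] is the pointwise meet; the empty meet is [cst 1%:i01] *)
Definition lowen_topology (S : Type) (tau : set (S -> I)) :=
  [/\ forall a : I, tau (cst a),
      forall F : set (S -> I), F `<=` tau -> tau (pjoin F)
    & forall u v : S -> I, tau u -> tau v -> tau (u `&` v)%O].

Lemma smallest_lowen (S : Type) (G : set (S -> I)) :
  lowen_topology (smallest (@lowen_topology S) G).
Proof.
split=> [a|F FG|u v Gu Gv] tau tauP.
- by case: tauP => -[tau1 _ _] _; exact: tau1.
- case: (tauP) => -[_ tau2 _] _; apply: tau2 => u /FG; exact.
- by case: (tauP) => -[_ _ tau3] _; apply: tau3; [exact: Gu|exact: Gv].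
Qed.

Record lowenSpace := LowenSpace {
  lowen_sort :> Type;
  fuzzy_open : set (lowen_sort -> I);
  fuzzy_openP : lowen_topology fuzzy_open }.

Arguments fuzzy_open : clear implicits.

Definition gen_lowen (S : Type) (G : set (S -> I)) : lowenSpace :=
  LowenSpace (@smallest_lowen S G).

Definition lcontinuous (S T : lowenSpace) (f : S -> T) :=
  forall v, fuzzy_open T v -> fuzzy_open S (v \o f).

Lemma gen_lowen_continuous (S : lowenSpace) (T : Type) (G : set (T -> I))
    (f : S -> T) :
  (forall v, G v -> fuzzy_open S (v \o f)) -> @lcontinuous S (gen_lowen G) f.
Proof.
move=> Gf.
suff : smallest (@lowen_topology T) G `<=` [set v : T -> I | fuzzy_open S (v \o f)]
  by move=> Gsub v Gv; exact: Gsub.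
apply: smallest_sub => //.
have [cstS joinS meetS] := fuzzy_openP S.
split=> [a|F FS|u w Su Sw] /=; [exact: cstS| |exact: meetS].
rewrite (_ : _ \o _ = pjoin [set u \o f | u in F]); last first.
  by apply/funext => x; rewrite /pjoin/= image_comp.
by apply: joinS => _ [u Fu <-]; exact: FS.
Qed.

Record lmap (S T : lowenSpace) := LMap {
  lmap_fun :> S -> T;
  lmapP : lcontinuous lmap_fun }.

Lemma lmapEP (S T : lowenSpace) (f g : lmap S T) : f =1 g -> f = g.
Proof.
case: f g => [f fP] [g gP] /= /funext fg; case: _ / fg in gP *.
by congr LMap; exact: Prop_irrelevance.
Qed.

Definition lmap_id (S : lowenSpace) : lmap S S :=
  @LMap S S idfun (fun v => id).

Definition lmap_comp (S T U : lowenSpace) (g : lmap T U) (f : lmap S T) : lmap S U :=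
  @LMap S U (g \o f) (fun v Uv => lmapP f (lmapP g Uv)).

Definition LFTS : category.
Proof.
refine (@Category lowenSpace lmap lmap_id lmap_comp _ _ _).
- by move=> S T f; exact: lmapEP.
- by move=> S T f; exact: lmapEP.
- by move=> S T U V h g f; exact: lmapEP.
Defined.

Definition lunit : lowenSpace := gen_lowen (@set0 (unit -> I)).

Definition lprod (S T : lowenSpace) : lowenSpace :=
  gen_lowen ([set v \o (@fst S T) | v in fuzzy_open S] `|`
             [set w \o (@snd S T) | w in fuzzy_open T]).

Definition lpower (S : lowenSpace) (n : nat) : lowenSpace :=
  gen_lowen (\bigcup_(i : 'I_n) [set v \o (fun r : 'I_n -> S => r i)
                                | v in fuzzy_open S]).

Lemma tt_lcontinuous (S : lowenSpace) : @lcontinuous S lunit (cst tt).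
Proof. exact: gen_lowen_continuous. Qed.

Lemma fst_lcontinuous (S T : lowenSpace) : @lcontinuous (lprod S T) S fst.
Proof. by move=> v Sv; apply: sub_gen_smallest; left; exists v. Qed.

Lemma snd_lcontinuous (S T : lowenSpace) : @lcontinuous (lprod S T) T snd.
Proof. by move=> v Sv; apply: sub_gen_smallest; right; exists v. Qed.

Lemma pair_lcontinuous (U S T : lowenSpace) (f : lmap U S) (g : lmap U T) :
  @lcontinuous U (lprod S T) (fun z => (f z, g z)).
Proof.
apply: gen_lowen_continuous => _ [[v Sv <-]|[v Tv <-]].
- exact: (lmapP f Sv).
- exact: (lmapP g Tv).
Qed.

Definition LFTS_products : finite_products LFTS.
Proof.
refine (@FiniteProducts LFTS lunit
  (fun S => LMap (@tt_lcontinuous S)) _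
  lprod
  (fun S T => LMap (@fst_lcontinuous S T))
  (fun S T => LMap (@snd_lcontinuous S T))
  (fun U S T f g => LMap (@pair_lcontinuous U S T f g)) _ _ _).
- by move=> S f; apply: lmapEP => x; case: (f x).
- by move=> U S T f g; exact: lmapEP.
- by move=> U S T f g; exact: lmapEP.
- by move=> U S T h; apply: lmapEP => z; exact: surjective_pairing.
Defined.

Definition fuzzy_lsc (X : topologicalType) : set (X -> I) :=
  [set u | forall t : I, open [set x | (t < u x)%O]].

Lemma lowen_fuzzy_lsc (X : topologicalType) : lowen_topology (@fuzzy_lsc X).
Proof.
split=> [a t|F FX t|u v Xu Xv t].
- have [ta|ta] := boolP (t < a)%O.
    by rewrite (_ : [set _ | _] = setT) ?predeqE//; exact: openT.
  by rewrite (_ : [set _ | _] = set0) ?predeqE//; exact: open0.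
- rewrite (_ : [set _ | _] = \bigcup_(u in F) [set x | (t < u x)%O]).
    by apply: bigcup_open => u /FX; exact.
  apply/seteqP; split=> x /=.
    by move=> /lt_isup[_ [u Fu <-] tu]; exists u.
  by move=> [u Fu tu]; apply/lt_isup; exists (u x) => //; exists u.
- rewrite (_ : [set _ | _] = [set x | (t < u x)%O] `&` [set x | (t < v x)%O]).
    by apply: openI; [exact: Xu|exact: Xv].
  by apply/seteqP; split=> x /=; rewrite lt_min => /andP.
Qed.

Definition omega (X : topologicalType) : lowenSpace :=
  LowenSpace (@lowen_fuzzy_lsc X).

Definition fuzzy_sierpinski : lowenSpace := gen_lowen [set @idfun I].

Section SKA.
Variable S : lowenSpace.

(* [<=] on [fuzzy_opens] is the pointwise order inherited from [S -> I] *)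
Definition fuzzy_opens := set_type (fuzzy_open S).

Lemma fuzzy_open_join (D : set fuzzy_opens) :
  fuzzy_open S (pjoin [set val u | u in D]).
Proof.
have [_ joinS _] := fuzzy_openP S.
by apply: joinS => _ [u _ <-]; exact: set_valP.
Qed.

Lemma fuzzy_open_cut (r : I) (u : fuzzy_opens) :
  fuzzy_open S (cst r `&` val u)%O.
Proof.
have [cstS _ meetS] := fuzzy_openP S.
by apply: meetS; [exact: cstS|exact: set_valP].
Qed.

Definition fjoin (D : set fuzzy_opens) : fuzzy_opens :=
  SigSub (mem_set (fuzzy_open_join D)).

Definition fcut (r : I) (u : fuzzy_opens) : fuzzy_opens :=
  SigSub (mem_set (fuzzy_open_cut r u)).

Definition scott_continuous (Phi : fuzzy_opens -> I) :=
  {homo Phi : u v / (u <= v)%O} /\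
  forall D : set fuzzy_opens, directed D -> Phi (fjoin D) = isup [set Phi u | u in D].

Definition finite_tier_compatible (Phi : fuzzy_opens -> I) :=
  forall (n : nat) (beta : 'I_n -> fuzzy_opens), (0 < n)%N ->
    fuzzy_open (lpower fuzzy_sierpinski n)
      (fun r => Phi (fjoin [set fcut (r i) (beta i) | i in [set: 'I_n]])).

Definition Sigma : set (fuzzy_opens -> I) :=
  [set Phi | scott_continuous Phi /\ finite_tier_compatible Phi].

(* the relation lam ◁ Phi *)
Definition core_below (lam : fuzzy_opens) (Phi : fuzzy_opens -> I) :=
  forall nu : fuzzy_opens, (fcut (Phi nu) lam <= nu)%O.

Definition SKA := forall mu : fuzzy_opens,
  mu = fjoin [set w | exists Phi lam,
    [/\ Sigma Phi, core_below lam Phi & w = fcut (Phi mu) lam]].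

End SKA.

End Lowen.

Arguments LFTS_products : clear implicits.
Arguments omega : clear implicits.

(* Main.v *)
Require Import Defs.
From HB Require Import structures.
From mathcomp Require Import all_boot all_order all_algebra.
From mathcomp Require Import all_classical all_reals interval_inference.
From mathcomp Require Import topology lra.

(** Every condition is compared with core-compactness of [X].

    _From exponentiability to core-compactness._ In either category, let [E] be
    the exponential of the (fuzzy) Sierpinski space by [X]; its points are the
    open sets (fuzzy open maps) of [X], and evaluation [E * X -> S] is
    continuous.  For [x] in an open set [V], continuity of evaluation at [(V, x)]
    yields a neighbourhood [B] of [V] in [E] and a neighbourhood [U] of [x] such
    that [U] is included in all the open sets that belong to [B].  Then [U] is
    way below [V]: given a directed family [D] with join [s] containing [V],
    topologize [opens X] so that the membership relation is open although an
    upward closed set containing [s] has to meet [D] in order to be open.  By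
    the universal property the tautological map [opens X -> E] is continuous,
    so the inverse image of [B] is open, contains [V], hence contains [s], hence
    meets [D] (lemmas [test_space_membership] and [way_below_test]).  The induced
    fuzzy space of this test space serves in the fuzzy case.

    _From SKA to core-compactness._ If the indicator of [V] is positive at [x]
    then some [Phi] and some [lam] core-below [Phi] satisfy [Phi 1_V > 0] and
    [lam x > 0].  Scott continuity of [Phi] on indicators turns [lam > 0] into an
    open set way below [V].

    _From core-compactness to the other conditions._ The way-below relation of a
    core-compact space interpolates.  In [Top], the space of continuous maps
    [X -> Y] is topologized so that [{f | U << f^-1 O}] is open, which makes
    evaluation continuous; interpolation gives the continuity of transposes.
    The fuzzy counterpart of [{f | U << f^-1 O}] is the functional
    [scott_core U] mapping [u : X -> [0, 1]] to the join of the [t] such that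
    [U << {u > t}].  The key fact is [fuzzy_open_scott_core]: when [w] is fuzzy
    open on [Z * X], so is [z |-> scott_core U (w (z, -))] on [Z].  It gives
    finite-tier compatibility, taking for [w] the join of the [r i /\ beta i], as
    well as the continuity of transposes into the fuzzy function space.  The
    functionals [scott_core U], tested against the indicators of the sets [U],
    recover every lower semicontinuous map, which is both SKA and the continuity
    of evaluation. *)

Set Implicit Arguments.
Unset Strict Implicit.
Unset Printing Implicit Defensive.

Import Order.TTheory GRing.Theory Num.Theory.

Local Open Scope classical_set_scope.
Local Open Scope ring_scope.

(** * The way-below relation between open sets *)

Section WayBelowOpens.
Variable X : topologicalType.
Implicit Types (U V W : opens X) (D : set (opens X)).

Definition to_opens (A : set X) (oA : open A) : opens X := SigSub (mem_set oA).

Lemma opens_open U : open (val U).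
Proof. exact: set_valP. Qed.

Lemma opens_leE U V : (U <= V)%O = (val U `<=` val V) :> Prop.
Proof. exact: subsetEset. Qed.

Lemma open_bigcup_val D : open (\bigcup_(W in D) val W).
Proof. by apply: bigcup_open => W _; exact: opens_open. Qed.

Definition opens_union D : opens X := to_opens (open_bigcup_val D).

Lemma supremums_opens_union D : supremums D (opens_union D).
Proof.
split=> [W DW|V ubV]; rewrite opens_leE => x /=; first by exists W.
by case=> W /ubV; rewrite opens_leE; apply.
Qed.

Lemma supremums_opensE D V : supremums D V -> val V = \bigcup_(W in D) val W.
Proof.
case=> ubV lubV; have [ubU lubU] := supremums_opens_union D.
suff -> : V = opens_union D by [].
by apply: (@le_anti _ (opens X)); rewrite lubV// lubU.
Qed.

Lemma way_below_le U V : way_below U V -> (U <= V)%O.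
Proof.
move=> /(_ [set V] V)[||//|W -> //]; last by rewrite supremums1.
by split=> [|_ _ -> ->]; exists V.
Qed.

Lemma le_way_below U V W : way_below U V -> (V <= W)%O -> way_below U W.
Proof. by move=> UV VW D S dD DS /(le_trans VW); exact: UV. Qed.

Lemma le_way_below_trans U V W :
  (U <= V)%O -> way_below V W -> way_below U W.
Proof.
move=> UV VW D S dD DS WS; have [T DT VT] := VW D S dD DS WS.
by exists T => //; exact: le_trans VT.
Qed.

Lemma way_below0 U V : val U = set0 -> way_below U V.
Proof.
move=> U0 D S [[W DW] _] _ _; exists W => //.
by rewrite opens_leE U0; exact: sub0set.
Qed.

Lemma way_below_union U1 U2 U V : val U = val U1 `|` val U2 ->
  way_below U1 V -> way_below U2 V -> way_below U V.
Proof.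
move=> UE U1V U2V D S dD DS VS.
have [W1 DW1 U1W1] := U1V D S dD DS VS.
have [W2 DW2 U2W2] := U2V D S dD DS VS.
have [W [DW W1W W2W]] := dD.2 W1 W2 DW1 DW2; exists W => //.
rewrite opens_leE UE subUset -!opens_leE.
by split; [exact: le_trans W1W|exact: le_trans W2W].
Qed.

(** Open sets satisfying a property stable under finite unions form a directed
    family, so the way-below relation can be used as relative compactness
    without extracting finite subcovers. *)
Lemma way_below_cover (P : set X -> Prop) U V : way_below U V ->
  P set0 -> (forall A B, P A -> P B -> P (A `|` B)) ->
  (forall x, val V x -> exists W : opens X, P (val W) /\ val W x) ->
  exists2 W : opens X, P (val W) & (U <= W)%O.
Proof.
move=> UV P0 PU PV; pose D := [set W : opens X | P (val W)].
have dD : directed D.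
  split=> [|W1 W2 DW1 DW2]; first by exists (to_opens open0).
  exists (to_opens (openU (opens_open W1) (opens_open W2))).
  split; [exact: PU| |]; rewrite opens_leE; first exact: subsetUl.
  exact: subsetUr.
have [|W] := UV D _ dD (supremums_opens_union D); last by exists W.
by rewrite opens_leE => x /PV[W [PW Wx]]; exists W.
Qed.

Lemma core_compact_continuous :
  core_compact X -> continuous_lattice (opens X).
Proof.
move=> ccX; split=> [D|V].
  by exists (opens_union D); exact: supremums_opens_union.
split=> [U /way_below_le//|W ubW]; rewrite opens_leE => x /ccX[U Ux /ubW].
by rewrite opens_leE; apply.
Qed.

Lemma continuous_core_compact :
  continuous_lattice (opens X) -> core_compact X.
Proof.
move=> [_ clX] V x; rewrite (supremums_opensE (clX V)) => -[U].
by exists U.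
Qed.

Hypothesis ccX : core_compact X.

(** In a core-compact space the open sets lying two steps below [V] still cover
    [V], and they are stable under finite unions; hence one of them contains
    [U]. *)
Lemma way_below_interpolation U V : way_below U V ->
  exists2 W, way_below U W & way_below W V.
Proof.
move=> UV.
pose P A := exists T W : opens X, [/\ val T = A, way_below T W & way_below W V].
have [||x Vx|W [T [T' [/val_inj-> TT' T'V]]] UW] := @way_below_cover P _ _ UV.
- exists (to_opens open0), (to_opens open0).
  by split=> //; exact: way_below0.
- move=> _ _ [T1 [W1 [<- TW1 WV1]]] [T2 [W2 [<- TW2 WV2]]].
  pose W := to_opens (openU (opens_open W1) (opens_open W2)).
  exists (to_opens (openU (opens_open T1) (opens_open T2))), W.
  split=> //; last exact: way_below_union WV1 WV2.
  apply: (@way_below_union T1 T2) => //.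
    by apply: (le_way_below TW1); rewrite opens_leE; exact: subsetUl.
  by apply: (le_way_below TW2); rewrite opens_leE; exact: subsetUr.
- have [W Wx WV] := ccX Vx; have [T Tx TW] := ccX Wx.
  by exists T; split=> //; exists T, W.
- by exists T' => //; exact: le_way_below_trans TT'.
Qed.

End WayBelowOpens.

(** * Exponentiability as a universal property *)

Section Universal.
Variables (C : category) (P : finite_products C) (A : C).
Local Notation "g ∘ f" := (cat_comp g f) (at level 40, left associativity).

Definition is_exponential (d e : C) (ev : cat_hom (prod_obj P e A) d) :=
  forall c (h : cat_hom (prod_obj P c A) d),
    exists! k : cat_hom c e, ev ∘ times_map P A k = h.

Lemma is_exponential_inj d e (ev : cat_hom (prod_obj P e A) d) c
    (k k' : cat_hom c e) : is_exponential ev ->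
  ev ∘ times_map P A k = ev ∘ times_map P A k' -> k = k'.
Proof.
move=> /(_ c (ev ∘ times_map P A k))[k0 [_ k0_uniq]] kk'.
by rewrite -(k0_uniq k erefl); apply: k0_uniq.
Qed.

Lemma exponentiable_universal : exponentiable P A ->
  forall d, exists e (ev : cat_hom (prod_obj P e A) d), is_exponential ev.
Proof.
move=> [G [phi [phi_bij phi_nat _]]] d.
have [psi phiK psiK] := phi_bij (G d) d.
exists (G d), (psi (cat_id (G d))) => c h.
have phiE (k : cat_hom c (G d)) :
    phi c d (psi (cat_id (G d)) ∘ times_map P A k) = k.
  by rewrite (phi_nat _ _ _ k) psiK cat_compidl.
exists (phi c d h); split=> [|k <-]; last exact: phiE.
by apply: (bij_inj (phi_bij c d)); rewrite phiE.
Qed.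

Lemma universal_exponentiable :
  (forall d, exists e (ev : cat_hom (prod_obj P e A) d), is_exponential ev) ->
  exponentiable P A.
Proof.
move=> /choice[E /(_ _)/cid-/all_sig[ev evP]].
have tr c d (h : cat_hom (prod_obj P c A) d) :
    {k : cat_hom c (E d) | ev d ∘ times_map P A k = h /\
      forall k', ev d ∘ times_map P A k' = h -> k = k'}.
  by apply: cid; exact: evP.
pose phi c d h := sval (tr c d h).
have phiE c d h : ev d ∘ times_map P A (phi c d h) = h.
  by case: (svalP (tr c d h)).
have phi_uniq c d h k : ev d ∘ times_map P A k = h -> phi c d h = k.
  by case: (svalP (tr c d h)) => _; apply.
have Gid d : phi _ _ (cat_id d ∘ ev d) = cat_id (E d).
  by apply: phi_uniq; rewrite times_map_id cat_compidl cat_compidr.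
have Gcomp a b c (g : cat_hom b c) (f : cat_hom a b) :
    phi _ _ ((g ∘ f) ∘ ev a) = phi _ _ (g ∘ ev b) ∘ phi _ _ (f ∘ ev a).
  apply: phi_uniq.
  by rewrite times_map_comp cat_compA phiE -cat_compA phiE cat_compA.
exists (@Functor C C E (fun a b g => phi _ _ (g ∘ ev a)) Gid Gcomp), phi.
split=> [c d|c c' d f h|c d d' g h] /=.
- exists (fun k => ev d ∘ times_map P A k) => [h|k]; first exact: phiE.
  exact: phi_uniq.
- by apply: phi_uniq; rewrite times_map_comp cat_compA phiE.
- by apply: phi_uniq; rewrite times_map_comp cat_compA phiE -cat_compA phiE.
Qed.

End Universal.

(** * Test spaces for the way-below relation *)

Section TestSpace.
Variables (X : topologicalType) (D : set (opens X)).

(** The Scott topology relative to the single directed family [D] of join [s].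
    The Scott topology itself does not do: unless [X] is core-compact, the
    membership relation between open sets and points is not open for it. *)
Definition scott_open_at (s : opens X) : set_system (opens X) :=
  [set T | (forall V W : opens X, T V -> (V <= W)%O -> T W) /\
           (T s -> exists2 W, D W & T W)].

Definition test_space (s : opens X) (dD : directed D) : Type := opens X.

Variables (s : opens X) (dD : directed D).

HB.instance Definition _ := Choice.on (test_space s dD).

Let scott_open_atT : scott_open_at s setT.
Proof. by split=> // _; have [[W DW] _] := dD; exists W. Qed.

Let scott_open_atI : setI_closed (scott_open_at s).
Proof.
move=> T1 T2 [up1 T1s] [up2 T2s].
split=> [V W [T1V T2V] VW|[/T1s[W1 DW1 T1W1] /T2s[W2 DW2 T2W2]]].
  by split; [exact: up1 VW|exact: up2 VW].
have [W [DW W1W W2W]] := dD.2 W1 W2 DW1 DW2.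
by exists W => //; split; [exact: up1 W1W|exact: up2 W2W].
Qed.

Let scott_open_at_bigU (I : Type) (f : I -> set (opens X)) :
  (forall i, scott_open_at s (f i)) -> scott_open_at s (\bigcup_i f i).
Proof.
move=> fP; split=> [V W [i _ fV] VW|[i _ /(fP i).2[W DW fW]]].
  by exists i => //; exact: (fP i).1 VW.
by exists W => //; exists i.
Qed.

HB.instance Definition _ := @isOpenTopological.Build (test_space s dD)
  (scott_open_at s) scott_open_atT scott_open_atI scott_open_at_bigU.

Lemma open_test_spaceE (T : set (test_space s dD)) :
  open T = scott_open_at s T.
Proof. by []. Qed.

(** Below [s], a point of [W] lies in some member [V] of [D], and the sets
    containing [W `&` V] form a neighbourhood of [W] since [V] is among them. *)
Lemma test_space_membership : supremums D s ->
  forall (W : test_space s dD) x, val (W : opens X) x ->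
  exists T : set (test_space s dD), exists O : set X,
    [/\ open T, open O, T W /\ O x &
        forall W' : test_space s dD, T W' -> O `<=` val (W' : opens X)].
Proof.
move=> Ds W x Wx.
pose up (V : opens X) : set (test_space s dD) :=
  [set W' : opens X | (V <= W')%O].
have [Ws|nWs] := pselect (W <= s)%O.
  have : val s x by move: Ws; rewrite opens_leE; exact.
  rewrite (supremums_opensE Ds) => -[V DV Vx].
  pose O := to_opens (openI (opens_open (W : opens X)) (opens_open V)).
  exists (up O), (val O); split; [rewrite open_test_spaceE; split| | |].
  - by move=> V1 V2 /= OV1 /(le_trans OV1).
  - by move=> _; exists V; rewrite //= /up/= opens_leE; exact: subIsetr.
  - exact: opens_open.
  - by split=> //; rewrite /up/= opens_leE; exact: subIsetl.
  - by move=> W'; rewrite /up/= opens_leE.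
exists (up W), (val (W : opens X)).
split; [rewrite open_test_spaceE; split| | |].
- by move=> V1 V2 /= OV1 /(le_trans OV1).
- by move=> /nWs.
- exact: opens_open.
- by split=> //; rewrite /up/=.
- by move=> W'; rewrite /up/= opens_leE.
Qed.

End TestSpace.

Lemma way_below_test (X : topologicalType) (U V : opens X) :
  (forall (D : set (opens X)) (s : opens X) (dD : directed D), supremums D s ->
    exists T : set (test_space s dD),
      [/\ open T, T V & forall W : opens X, T W -> (U <= W)%O]) ->
  way_below U V.
Proof.
move=> test D s dD Ds Vs; have [T [[upT Ts] TV TU]] := test D s dD Ds.
have [W DW /TU UW] : exists2 W, D W & T W by apply/Ts/(upT V).
by exists W.
Qed.

(** * Exponentiable topological spaces are core-compact *)

Lemma Top_homP (X Y : topologicalType) (f g : @cat_hom Top X Y) :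
  (f : continuousType X Y) =1 (g : continuousType X Y) -> f = g.
Proof.
by move=> fg; exact: ((continuousEP (f : continuousType X Y) g).2 fg).
Qed.

Lemma Top_homE (X Y : topologicalType) (f g : @cat_hom Top X Y) :
  f = g -> (f : continuousType X Y) =1 (g : continuousType X Y).
Proof. by move=> ->. Qed.

Definition sierpinski : Type := bool.

HB.instance Definition _ := Choice.on sierpinski.

Definition sierpinski_open : set_system sierpinski :=
  [set T | T false -> T true].

Lemma sierpinski_openI : setI_closed sierpinski_open.
Proof. by move=> A B oA oB [/oA At /oB Bt]. Qed.

Lemma sierpinski_open_bigU (I : Type) (f : I -> set sierpinski) :
  (forall i, sierpinski_open (f i)) -> sierpinski_open (\bigcup_i f i).
Proof. by move=> of_ [i _ /of_ fit]; exists i. Qed.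

HB.instance Definition _ := @isOpenTopological.Build sierpinski
  sierpinski_open (fun=> I) sierpinski_openI sierpinski_open_bigU.

Lemma open_sierpinski_true : open [set true : sierpinski].
Proof. by []. Qed.

Lemma continuous_sierpinski (Z : topologicalType) (A : set Z) :
  open A -> continuous (fun z => `[< A z >] : sierpinski).
Proof.
move=> oA; apply/continuousP => T oT.
have [Tt|nTt] := pselect (T true); last first.
  rewrite (_ : _ @^-1` _ = set0); first exact: open0.
  by apply/seteqP; split=> z //=; case: asboolP => _ // /oT.
have [Tf|nTf] := pselect (T false).
  rewrite (_ : _ @^-1` _ = setT); first exact: openT.
  by apply/seteqP; split=> z //= _; case: asboolP.
rewrite (_ : _ @^-1` _ = A)//.
by apply/seteqP; split=> z /=; case: asboolP.
Qed.

Lemma open_prodP (S T : topologicalType) (A : set (S * T)) :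
  open A <-> forall p, A p -> exists B C,
    [/\ open B, open C, B p.1 /\ C p.2 & B `*` C `<=` A].
Proof.
split=> [oA p Ap|AP].
  have /= [[B C] /= [Bp Cp] BCA] : nbhs p A by exact: open_nbhs_nbhs.
  move: Bp Cp; rewrite !nbhsE => -[B' [oB' B'p] B'B] [C' [oC' C'p] C'C].
  exists B', C'; split=> // -[x y] [/= B'x C'y]; apply: BCA.
  by split; [exact: B'B|exact: C'C].
rewrite openE => p /AP[B [C [oB oC [Bp Cp] BCA]]].
by exists (B, C) => //; split; exact: open_nbhs_nbhs.
Qed.

Theorem Top_exponentiable_core_compact (X : topologicalType) :
  exponentiable Top_products X -> core_compact X.
Proof.
move=> /exponentiable_universal/(_ (sierpinski : topologicalType)).
move=> [E [ev evP]] V x Vx.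
have slice (Z : topologicalType) (A : set (Z * X)) (oA : open A) :
    exists k : continuousType Z E,
      forall z y, ev (k z, y) = `[< A (z, y) >].
  have [k [kE _]] :=
    evP Z (mkcts (continuous_sierpinski oA) : continuousType _ _).
  by exists k => z y; have /(_ (z, y)) := Top_homE kE.
(* The points of [E] are open sets of [X]: they are determined by evaluation. *)
have points (e e' : E) : (forall y, ev (e, y) = ev (e', y)) -> e = e'.
  move=> ee'.
  pose c (p : E) : @cat_hom Top unit E := (cst p : continuousType unit E).
  have /Top_homE/(_ tt)// : c e = c e'.
  apply: (is_exponential_inj evP).
  by apply: Top_homP => -[u y]; exact: (ee' y).
have oV : open [set p : unit * X | val V p.2].
  by apply: open_comp (opens_open V) => p _; exact: snd_continuous.
have [k0 k0E] := slice _ _ oV.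
have oev : open ((ev : continuousType _ _) @^-1` [set true : sierpinski]).
  by apply: open_comp open_sierpinski_true => p _; exact: cts_fun.
have [|B [C [oB oC [/= Bk0 Cx] BCev]]] := (open_prodP _).1 oev (k0 tt, x).
  by rewrite /= k0E; apply/asboolP.
exists (to_opens oC) => //.
apply: way_below_test => D s dD Ds.
have oM : open [set p : test_space s dD * X | val (p.1 : opens X) p.2].
  apply/open_prodP => -[W y] /= Wy.
  have [T [O [oT oO TO TOW]]] := test_space_membership Ds Wy.
  by exists T, O; split=> // -[W' y'] [/= /TOW]; exact.
have [k kE] := slice _ _ oM.
exists (k @^-1` B); split.
- by apply: open_comp oB => z _; exact: cts_fun.
- rewrite /= (_ : k V = k0 tt)//; apply: points => y.
  by rewrite kE k0E; apply: asbool_equiv_eq; split=> //= -[].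
- move=> W BW; rewrite opens_leE => y Cy.
  have /= := BCev (k W, y) (conj BW Cy).
  by rewrite kE => /asboolP.
Qed.

(** * Core-compact topological spaces are exponentiable *)

Section FunctionSpace.
Variables X Y : topologicalType.

Definition function_space : Type := continuousType X Y.

HB.instance Definition _ := Choice.on function_space.

(** The finest topology for which transposes are continuous: only the continuity
    of evaluation is left to prove. *)
Definition transpose_open : set_system function_space :=
  [set T | forall (Z : topologicalType) (h : continuousType (Z * X)%type Y)
     (k : Z -> continuousType X Y),
     (forall z x, k z x = h (z, x)) -> open (k @^-1` T)].

Let transpose_openT : transpose_open setT.
Proof. by move=> Z h k _; rewrite preimage_setT; exact: openT. Qed.

Let transpose_openI : setI_closed transpose_open.
Proof.
move=> T1 T2 oT1 oT2 Z h k kh; rewrite preimage_setI.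
by apply: openI; [exact: oT1 kh|exact: oT2 kh].
Qed.

Let transpose_open_bigU (I : Type) (f : I -> set function_space) :
  (forall i, transpose_open (f i)) -> transpose_open (\bigcup_i f i).
Proof.
move=> of_ Z h k kh; rewrite preimage_bigcup.
by apply: bigcup_open => i _; exact: of_ kh.
Qed.

HB.instance Definition _ := @isOpenTopological.Build function_space
  transpose_open transpose_openT transpose_openI transpose_open_bigU.

Lemma open_function_spaceE (T : set function_space) :
  open T = transpose_open T.
Proof. by []. Qed.

Lemma transpose_continuous (Z : topologicalType)
    (h : continuousType (Z * X)%type Y) (k : Z -> function_space) :
  (forall z x, (k z : continuousType X Y) x = h (z, x)) -> continuous k.
Proof. by move=> kh; apply/continuousP => T; exact. Qed.

Hypothesis ccX : core_compact X.

Definition way_below_preimage (U : opens X) (O : set Y) : set function_space :=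
  [set f | exists2 W : opens X,
     way_below U W & val W `<=` (f : continuousType X Y) @^-1` O].

(** If [U] is way below the section of [h^-1 O] at [z], interpolate some [W]
    between them: finitely many boxes inside [h^-1 O] cover [W], so [W] is
    contained in the sections at all points near [z]. *)
Lemma open_way_below_preimage (U : opens X) (O : set Y) : open O ->
  open (way_below_preimage U O).
Proof.
move=> oO; rewrite open_function_spaceE => Z h k kh.
rewrite openE => z [V UV VkO].
have [W UW WV] := way_below_interpolation ccX UV.
pose P A := exists2 N, open_nbhs z N & N `*` A `<=` h @^-1` O.
have [||x Vx|W' [N [oN Nz] NWO] WW'] := @way_below_cover _ P _ _ WV.
- by exists setT; [split=> //; exact: openT|rewrite setX0; exact: sub0set].
- move=> A B [N oN NA] [M oM MB]; exists (N `&` M); first exact: open_nbhsI.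
  move=> [z' x] [[/= Nz' Mz'] [Ax|Bx]]; first exact: (NA (z', x)).
  exact: (MB (z', x)).
- have ohO : open (h @^-1` O) by apply: open_comp oO => p _; exact: cts_fun.
  have [|N [C [oN oC [/= Nz Cx] NC]]] := (open_prodP _).1 ohO (z, x).
    by rewrite /= -kh; exact: VkO.
  by exists (to_opens oC); split=> //; exists N.
rewrite /interior nbhsE; exists N => // z' Nz' /=; exists W => // x Wx /=.
by rewrite kh; apply: NWO; split=> //=; move: WW'; rewrite opens_leE; exact.
Qed.

Definition evaluation (p : function_space * X) : Y :=
  (p.1 : continuousType X Y) p.2.

Lemma evaluation_continuous : continuous evaluation.
Proof.
apply/continuousP => O oO; apply/open_prodP => -[f x] fxO.
have ofO : open ((f : continuousType X Y) @^-1` O).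
  by apply: open_comp oO => y _; exact: cts_fun.
have [U Ux UfO] := @ccX (to_opens ofO) x fxO.
exists (way_below_preimage U O), (val U).
split; [exact: open_way_below_preimage|exact: opens_open| |].
  by split=> //; exists (to_opens ofO).
move=> [g y] [/= [W UW WgO] Uy]; apply: WgO.
by move: (way_below_le UW); rewrite opens_leE; exact.
Qed.

End FunctionSpace.

Theorem core_compact_Top_exponentiable (X : topologicalType) :
  core_compact X -> exponentiable Top_products X.
Proof.
move=> ccX; apply: universal_exponentiable => Y.
exists (function_space X Y : topologicalType).
exists (mkcts (evaluation_continuous ccX) : continuousType _ Y) => Z h.
have sectionC (z : Z) :
    continuous (fun x : X => (h : continuousType _ _) (z, x)).
  move=> x; apply: (@continuous_comp _ _ _ (fun x => (z, x)) h).
    by apply: cvg_pair; [exact: cvg_cst|exact: cvg_id].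
  exact: cts_fun.
pose k z : function_space X Y := mkcts (sectionC z) : continuousType X Y.
have kC : continuous k by apply: (@transpose_continuous _ _ _ h).
exists (mkcts kC : continuousType Z (function_space X Y)); split.
  by apply: Top_homP => -[z x].
move=> k' k'h; apply: Top_homP => z.
apply: (continuousEP (k z : continuousType X Y) _).2 => x.
by have /(_ (z, x)) := Top_homE k'h.
Qed.

(** * Joins in the unit interval *)

Section Fuzzy.
Variable R : realType.
Local Notation I := {i01 R}.
Arguments fuzzy_open {R} _ _.

Lemma i01_ge0 (a : I) : (0%:i01 <= a)%O.
Proof. by rewrite -num_le/=; exact: ge0. Qed.

Lemma i01_le1 (a : I) : (a <= 1%:i01)%O.
Proof. by rewrite -num_le/=; exact: le1. Qed.

Lemma i01_lt01 : (0%:i01 < 1%:i01 :> I)%O.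
Proof. by rewrite -num_lt/= ltr01. Qed.

Lemma i01_dense (a b : I) : (a < b)%O -> exists2 t : I, (a < t)%O & (t < b)%O.
Proof.
rewrite -num_lt => ab.
have a0 : 0 <= a%:num :> R by exact: ge0.
have b1 : b%:num <= 1 :> R by exact: le1.
have m0 : 0 <= (a%:num + b%:num) / 2 :> R by lra.
have m1 : (a%:num + b%:num) / 2 <= 1 :> R by lra.
by exists (Itv01 m0 m1); rewrite -num_lt/=; lra.
Qed.

Lemma le_of_lt (a b : I) : (forall t, (t < a)%O -> (t <= b)%O) -> (a <= b)%O.
Proof.
move=> ab; rewrite leNgt; apply/negP => /i01_dense[t bt /ab].
by rewrite leNgt bt.
Qed.

Lemma isup_ub (A : set I) a : A a -> (a <= isup A)%O.
Proof. exact: (isupP A).1. Qed.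

Lemma isup_le (A : set I) b : (forall a, A a -> (a <= b)%O) -> (isup A <= b)%O.
Proof. exact: (isupP A).2. Qed.

Lemma lt_pjoin (S : Type) (F : set (S -> I)) x t :
  (t < pjoin F x)%O <-> exists2 u, F u & (t < u x)%O.
Proof.
split=> [/lt_isup[_ [u Fu <-] tu]|[u Fu tu]]; first by exists u.
by apply/lt_isup; exists (u x) => //; exists u.
Qed.

Lemma lt_pmeet (S : Type) (u v : S -> I) x t :
  (t < (u `&` v)%O x)%O = (t < u x)%O && (t < v x)%O.
Proof. by rewrite /= lt_min. Qed.

Lemma le_pmeet (S : Type) (u v : S -> I) x t :
  (t <= (u `&` v)%O x)%O = (t <= u x)%O && (t <= v x)%O.
Proof. by rewrite /= le_min. Qed.

(** * Fuzzy open maps *)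

Section LowenTheory.
Implicit Types S T : lowenSpace R.

Lemma fuzzy_open_cst S a : fuzzy_open S (cst a).
Proof. by have [] := fuzzy_openP S. Qed.

Lemma fuzzy_open_meet S u v :
  fuzzy_open S u -> fuzzy_open S v -> fuzzy_open S (u `&` v)%O.
Proof. by have [_ _] := fuzzy_openP S; apply. Qed.

(** Closure under arbitrary joins makes fuzzy openness a local property: [w] is
    then the join of the fuzzy open maps below it. *)
Lemma fuzzy_open_local S (w : S -> I) :
  (forall x t, (t < w x)%O -> exists u,
     [/\ fuzzy_open S u, (t < u x)%O & forall y, (u y <= w y)%O]) ->
  fuzzy_open S w.
Proof.
move=> loc; pose F := [set u | fuzzy_open S u /\ forall y, (u y <= w y)%O].
suff -> : w = pjoin F.
  by have [_ joinS _] := fuzzy_openP S; apply: joinS => u [].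
apply/funext => x; apply/eqP; rewrite eq_le; apply/andP; split.
  apply: le_of_lt => t /loc[u [Su tu uw]]; apply: ltW.
  by apply/lt_pjoin; exists u.
by apply: isup_le => _ [u [_ uw] <-].
Qed.

(** Joins of rectangles already form a Lowen topology: a rectangle whose sides
    are the same constant is that constant, and a meet of two rectangles is a
    rectangle. *)
Lemma lprod_rectangle S T (w : S * T -> I) : fuzzy_open (lprod S T) w ->
  forall x y t, (t < w (x, y))%O -> exists a b,
  [/\ fuzzy_open S a, fuzzy_open T b, (t < a x)%O, (t < b y)%O &
      forall x' y', (a x' `&` b y' <= w (x', y'))%O].
Proof.
pose loc (w : S * T -> I) := forall x y t, (t < w (x, y))%O -> exists a b,
  [/\ fuzzy_open S a, fuzzy_open T b, (t < a x)%O, (t < b y)%O &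
      forall x' y', (a x' `&` b y' <= w (x', y'))%O].
suff : fuzzy_open (lprod S T) `<=` [set w | loc w] by exact.
apply: smallest_sub => [|_ [[a Sa <-]|[b Tb <-]] x y t /= tw].
- split=> [c|F Floc|u v uloc vloc] x y t.
  + move=> tc; exists (cst c), (cst c); split=> //; try exact: fuzzy_open_cst.
    by move=> x' y' /=; rewrite meetxx.
  + move=> /lt_pjoin[u Fu /(Floc u Fu)[a [b [Sa Tb ta tb ab]]]].
    exists a, b; split=> // x' y'; apply: (le_trans (ab x' y')).
    by apply: isup_ub; exists u.
  + rewrite lt_pmeet => /andP[/uloc[a [b [Sa Tb ta tb ab]]]].
    move=> /vloc[a' [b' [Sa' Tb' ta' tb' ab']]].
    exists (a `&` a')%O, (b `&` b')%O.
    split; rewrite ?lt_pmeet ?ta ?tb//; try exact: fuzzy_open_meet.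
    move=> x' y'; rewrite le_pmeet; apply/andP; split.
      by apply: le_trans (ab x' y'); apply: leI2; exact: leIl.
    by apply: le_trans (ab' x' y'); apply: leI2; exact: leIr.
- exists a, (cst 1%:i01); split=> //; first exact: fuzzy_open_cst.
    by apply: (lt_le_trans tw); exact: i01_le1.
  by move=> x' y'; exact: leIl.
- exists (cst 1%:i01), b; split=> //; first exact: fuzzy_open_cst.
    by apply: (lt_le_trans tw); exact: i01_le1.
  by move=> x' y'; exact: leIr.
Qed.

Lemma fuzzy_sierpinski_id : fuzzy_open (fuzzy_sierpinski R) idfun.
Proof. exact: sub_gen_smallest. Qed.

Lemma LFTS_homE S T (f g : @cat_hom (LFTS R) S T) :
  f = g -> (f : lmap S T) =1 (g : lmap S T).
Proof. by move=> ->. Qed.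

End LowenTheory.

Section FuzzyOpens.
Variable S : lowenSpace R.

Definition to_fuzzy_opens (u : S -> I) (ou : fuzzy_open S u) : fuzzy_opens S :=
  SigSub (mem_set ou).

Lemma fuzzy_opens_open (u : fuzzy_opens S) : fuzzy_open S (val u).
Proof. exact: set_valP. Qed.

Lemma fuzzy_opens_leP (u v : fuzzy_opens S) :
  reflect (forall x, (val u x <= val v x)%O) (u <= v)%O.
Proof. exact: lefP. Qed.

Lemma lt_fjoin (D : set (fuzzy_opens S)) x t :
  (t < val (fjoin D) x)%O <-> exists2 u, D u & (t < val u x)%O.
Proof.
split=> [/lt_pjoin[_ [u Du <-] tu]|[u Du tu]]; first by exists u.
by apply/lt_pjoin; exists (val u) => //; exists u.
Qed.

End FuzzyOpens.

Section Indicator.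
Variable X : topologicalType.

Definition indicator (A : set X) : X -> I :=
  fun x => if `[< A x >] then 1%:i01 else 0%:i01.

Lemma indicatorP (A : set X) x t : (t < indicator A x)%O -> A x.
Proof. by rewrite /indicator; case: asboolP => // _; rewrite ltNge i01_ge0. Qed.

Lemma indicator1 (A : set X) x : A x -> indicator A x = 1%:i01.
Proof. by rewrite /indicator; case: asboolP. Qed.

Lemma le_indicator (A : set X) (a : I) x :
  ((0%:i01 < a)%O -> A x) -> (a <= indicator A x)%O.
Proof.
rewrite /indicator; case: asboolP => [_ _|nA a0]; first exact: i01_le1.
by rewrite leNgt; apply/negP => /a0.
Qed.

Lemma fuzzy_open_indicator (V : opens X) :
  fuzzy_open (omega R X) (indicator (val V)).
Proof.
move=> t; have [t1|t1] := boolP (t < 1%:i01)%O.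
  rewrite (_ : [set _ | _] = val V); first exact: opens_open.
  by apply/seteqP; split=> x /= => [/indicatorP//|Vx]; rewrite indicator1.
rewrite (_ : [set _ | _] = set0); first exact: open0.
apply/seteqP; split=> x //= tx.
by move: t1; rewrite (lt_le_trans tx (i01_le1 _)).
Qed.

Definition indicator_open (V : opens X) : fuzzy_opens (omega R X) :=
  to_fuzzy_opens (fuzzy_open_indicator V).

End Indicator.

(** * The functionals attached to open sets *)

Section ScottCore.
Variable X : topologicalType.
Implicit Types (U V W : opens X) (u : X -> I).

(** This is the join of the [t] such that [U << {u > t}]; the intermediate open
    set [W] gives the formula a meaning when [{u > t}] is not open. *)
Definition scott_core U u : I :=
  isup [set t | exists2 W : opens X,
          way_below U W & forall y, val W y -> (t < u y)%O].

Lemma lt_scott_core U u t : (t < scott_core U u)%O <->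
  exists2 t', (t < t')%O &
    exists2 W : opens X, way_below U W & forall y, val W y -> (t' < u y)%O.
Proof. by rewrite /scott_core lt_isup; split=> -[t' ? ?]; exists t'. Qed.

Lemma scott_core_le U u x : val U x -> (scott_core U u <= u x)%O.
Proof.
move=> Ux; apply: isup_le => t [W UW tu]; apply/ltW/tu.
by have := way_below_le UW; rewrite opens_leE; apply.
Qed.

Hypothesis ccX : core_compact X.

Lemma scott_core_approx u x t : fuzzy_open (omega R X) u -> (t < u x)%O ->
  exists U, val U x /\ (t < scott_core U u)%O.
Proof.
move=> ou /i01_dense[t' tt' t'u].
have [U Ux UV] := @ccX (to_opens (ou t')) x t'u.
exists U; split=> //; apply/lt_scott_core; exists t' => //.
by exists (to_opens (ou t')).
Qed.

(** Suppose that [w (z, -) > t] on an open set way above [U], and interpolate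
    some [W]. Around each of its points a rectangle below [w], with first side
    cut at [t], gives a fuzzy open [a] such that [a z >= t] and
    [a z' <= w (z', -)] on a neighbourhood of the point. Such pairs are stable
    under finite unions of the neighbourhoods and meets of the [a], so that a
    single [a] works on the whole of [W]. *)
Lemma fuzzy_open_scott_core (Z : lowenSpace R) (w : Z * X -> I) U :
  fuzzy_open (lprod Z (omega R X)) w ->
  fuzzy_open Z (fun z => scott_core U (fun x => w (z, x))).
Proof.
move=> ow; apply: fuzzy_open_local => z t0 /lt_scott_core[t t0t [V UV Vw]].
have [W UW WV] := way_below_interpolation ccX UV.
pose P (A : set X) := exists a, [/\ fuzzy_open Z a, (t <= a z)%O &
  forall z' x, A x -> (a z' <= w (z', x))%O].
have [||x Vx|W' [a [oa ta aw]] WW'] := @way_below_cover _ P _ _ WV.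
- by exists (cst t); split=> //; exact: fuzzy_open_cst.
- move=> A B [a [oa ta aw]] [b [ob tb bw]]; exists (a `&` b)%O.
  split; [exact: fuzzy_open_meet|by rewrite le_pmeet ta|].
  move=> z' x [Ax|Bx].
    by apply: le_trans (aw z' x Ax); exact: leIl.
  by apply: le_trans (bw z' x Bx); exact: leIr.
- have [a [b [oa ob ta tb ab]]] := lprod_rectangle ow (Vw x Vx).
  exists (to_opens (ob t)); split=> //; exists (a `&` cst t)%O.
  split; first by apply: fuzzy_open_meet => //; exact: fuzzy_open_cst.
    by rewrite le_pmeet /= lexx ltW.
  move=> z' x' /= tb'; apply: le_trans (ab z' x').
  by apply: leI2 => //; exact: ltW.
exists a; split=> // [|z']; first exact: lt_le_trans ta.
apply: le_of_lt => s sa; apply: isup_ub; exists W => // y Wy.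
by apply: (lt_le_trans sa); apply: aw; move: WW'; rewrite opens_leE; exact.
Qed.

Definition core_functional U (mu : fuzzy_opens (omega R X)) : I :=
  scott_core U (val mu).

Lemma core_functional_mono U : {homo core_functional U : u v / (u <= v)%O}.
Proof.
move=> u v /fuzzy_opens_leP uv; apply: isup_le => t [W UW tu].
by apply: isup_ub; exists W => // y Wy; exact: lt_le_trans (tu y Wy) (uv y).
Qed.

(** If the join of [D] exceeds [t] on an open set way above [U], interpolation
    and directedness provide one member of [D] exceeding [t] on an open set
    still way above [U]. *)
Lemma core_functional_scott U : scott_continuous (core_functional U).
Proof.
split=> [|D dD]; first exact: core_functional_mono.
apply/eqP; rewrite eq_le; apply/andP; split; last first.
  apply: isup_le => _ [u Du <-]; apply: core_functional_mono.
  by apply/fuzzy_opens_leP => x; apply: isup_ub; exists (val u) => //; exists u.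
apply: le_of_lt => t0 /lt_scott_core[t t0t [V UV Vt]].
have [W UW WV] := way_below_interpolation ccX UV.
pose P (A : set X) := exists2 u, D u & forall y, A y -> (t < val u y)%O.
have [||x Vx|W' [u Du tu] WW'] := @way_below_cover _ P _ _ WV.
- by have [[u Du] _] := dD; exists u.
- move=> A B [u Du Au] [v Dv Bv]; have [w [Dw uw vw]] := dD.2 u v Du Dv.
  exists w => // y [Ay|By].
    by apply: lt_le_trans (Au y Ay) _; exact: (fuzzy_opens_leP _ _ uw).
  by apply: lt_le_trans (Bv y By) _; exact: (fuzzy_opens_leP _ _ vw).
- have /lt_fjoin[u Du tu] := Vt x Vx.
  by exists (to_opens (fuzzy_opens_open u t)); split=> //; exists u.
apply: ltW; apply/lt_isup; exists (core_functional U u); first by exists u.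
apply/lt_scott_core; exists t => //; exists W => // y Wy.
by apply: tu; move: WW'; rewrite opens_leE; exact.
Qed.

(** Finite-tier compatibility is fuzzy openness of [scott_core U] along the map
    [(r, x) |-> \/_i (r i /\ beta i x)], fuzzy open on the product of the power
    of the fuzzy Sierpinski space with the induced space of [X]. *)
Lemma core_functional_tier U : finite_tier_compatible (core_functional U).
Proof.
move=> n beta _; pose Sn := lpower (fuzzy_sierpinski R) n.
pose w (p : ('I_n -> I) * X) :=
  val (fjoin [set fcut (p.1 i) (beta i) | i in [set: 'I_n]]) p.2.
apply: (@fuzzy_open_scott_core Sn w).
apply: fuzzy_open_local => -[r x] t /lt_fjoin[_ [i _ <-] tr].
exists ((fun p : ('I_n -> I) * X => p.1 i) `&` (fun p => val (beta i) p.2))%O.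
split=> //.
- apply: fuzzy_open_meet.
    apply: (@fst_lcontinuous R Sn (omega R X) (fun r : 'I_n -> I => r i)).
    apply: sub_gen_smallest; exists i => //; exists idfun => //.
    exact: fuzzy_sierpinski_id.
  apply: (@snd_lcontinuous R Sn (omega R X) (val (beta i))).
  exact: fuzzy_opens_open.
- move=> [r' y]; apply: isup_ub; exists (val (fcut (r' i) (beta i))) => //.
  by exists (fcut (r' i) (beta i)) => //; exists i.
Qed.

Lemma core_below_indicator U :
  core_below (indicator_open U) (core_functional U).
Proof.
move=> nu; apply/fuzzy_opens_leP => y.
apply: le_of_lt => t; rewrite lt_pmeet => /andP[/= tU /indicatorP Uy].
exact: ltW (lt_le_trans tU (scott_core_le _ Uy)).
Qed.

End ScottCore.

(** * Core-compactness and SKA *)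

Section SKA.
Variable X : topologicalType.

Lemma indicator_open_le (W W' : opens X) :
  (W <= W')%O -> (indicator_open W <= indicator_open W')%O.
Proof.
move=> WW'; apply/fuzzy_opens_leP => y; apply: le_indicator => /indicatorP.
by move: WW'; rewrite opens_leE; exact.
Qed.

Theorem SKA_core_compact : SKA (omega R X) -> core_compact X.
Proof.
move=> ska V x Vx; pose chi W : fuzzy_opens (omega R X) := indicator_open W.
have : (0%:i01 < val (chi V) x)%O by rewrite /= indicator1//; exact: i01_lt01.
rewrite {1}(ska (chi V)) => /lt_fjoin[_ [Phi [lam [SPhi lamPhi ->]]]].
rewrite lt_pmeet => /andP[/= PhiV lamx].
exists (to_opens (fuzzy_opens_open lam 0%:i01)) => // D s dD Ds Vs.
have dchi : directed (chi @` D).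
  case: dD => -[W0 DW0] dD; split; first by exists (chi W0), W0.
  move=> _ _ [W1 DW1 <-] [W2 DW2 <-].
  have [W [DW W1W W2W]] := dD _ _ DW1 DW2; exists (chi W).
  by split; [exists W|exact: indicator_open_le|exact: indicator_open_le].
have chis : (chi s <= fjoin (chi @` D))%O.
  apply/fuzzy_opens_leP => y; apply: le_of_lt => t /[dup] /indicatorP.
  rewrite (supremums_opensE Ds) => -[W DW Wy] ts; apply/ltW/lt_fjoin.
  exists (chi W); first by exists W.
  by apply: (lt_le_trans ts); rewrite [in leRHS]/= (indicator1 Wy) i01_le1.
have [[Phi_mono Phi_join] _] := SPhi.
have Vchis := le_trans (indicator_open_le Vs) chis.
have := lt_le_trans PhiV (Phi_mono _ _ Vchis).
rewrite Phi_join// => /lt_isup[_ [_ [W DW <-] <-] PhiW].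
exists W => //; rewrite opens_leE => y /= lamy.
apply: (@indicatorP _ _ _ 0%:i01).
have /fuzzy_opens_leP/(_ y) := lamPhi (chi W); apply: lt_le_trans.
by rewrite lt_pmeet; apply/andP.
Qed.

Theorem core_compact_SKA : core_compact X -> SKA (omega R X).
Proof.
move=> ccX mu.
apply: (@le_anti _ (fuzzy_opens (omega R X))); apply/andP; split.
  apply/fuzzy_opens_leP => x; apply: le_of_lt => t tmu; apply/ltW/lt_fjoin.
  have [U [Ux tU]] := scott_core_approx ccX (fuzzy_opens_open mu) tmu.
  exists (fcut (core_functional U mu) (indicator_open U)).
    exists (core_functional U), (indicator_open U).
    split=> //; last exact: core_below_indicator.
    by split; [exact: core_functional_scott|exact: core_functional_tier].
  by rewrite lt_pmeet /= tU indicator1//; apply: lt_le_trans tU (i01_le1 _).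
apply/fuzzy_opens_leP => x; apply: isup_le.
move=> _ [_ [_ [Phi [lam [_ lamPhi ->]]] <-] <-].
exact: (fuzzy_opens_leP _ _ (lamPhi mu)).
Qed.

End SKA.

(** * Core-compactness and fuzzy exponentiability *)

Section LFTSExponential.
Variable X : topologicalType.
Local Notation oX := (omega R X).

Theorem LFTS_exponentiable_core_compact :
  exponentiable (LFTS_products R) oX -> core_compact X.
Proof.
move=> /exponentiable_universal/(_ (fuzzy_sierpinski R))[E [ev evP]] V x Vx.
have slice (Z : lowenSpace R) (w : Z * X -> I) :
    fuzzy_open (lprod Z oX) w ->
    exists k : lmap Z E, forall z y, ev (k z, y) = w (z, y).
  move=> ow.
  have wC : @lcontinuous _ (lprod Z oX) (fuzzy_sierpinski R) w.
    by apply: gen_lowen_continuous => _ ->.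
  have [k [kE _]] := evP Z (LMap wC).
  by exists k => z y; have /(_ (z, y)) := LFTS_homE kE.
(* The points of [E] are fuzzy open maps: they are determined by evaluation. *)
have points (e e' : E) : (forall y, ev (e, y) = ev (e', y)) -> e = e'.
  move=> ee'.
  have cC (p : E) : @lcontinuous _ (lunit R) E (cst p).
    by move=> v _; exact: (fuzzy_open_cst (lunit R) (v p)).
  pose c p : @cat_hom (LFTS R) (lunit R) E := LMap (cC p).
  have /LFTS_homE/(_ tt)// : c e = c e'.
  apply: (is_exponential_inj evP).
  by apply: lmapEP => -[u y]; exact: (ee' y).
have oV : fuzzy_open (lprod (lunit R) oX) (indicator (val V) \o snd).
  by apply: snd_lcontinuous; exact: fuzzy_open_indicator.
have [k0 k0E] := slice _ _ oV.
have oev : fuzzy_open (lprod E oX) ev by exact: (lmapP ev fuzzy_sierpinski_id).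
have [|a [b [oa ob a0 b0 ab]]] :=
    lprod_rectangle oev (x := k0 tt) (y := x) (t := 0%:i01).
  by rewrite k0E /= indicator1//; exact: i01_lt01.
exists (to_opens (ob 0%:i01)) => //.
apply: way_below_test => D s dD Ds.
pose w (p : test_space s dD * X) : I := indicator (val (p.1 : opens X)) p.2.
have ow : fuzzy_open (lprod (omega R (test_space s dD)) oX) w.
  apply: fuzzy_open_local => -[W y] t tw.
  have [T [O [oT oO [TW Oy] TOW]]] := test_space_membership Ds (indicatorP tw).
  pose chiT := indicator (val (to_opens oT)).
  pose chiO := indicator (val (to_opens oO)).
  exists ((chiT \o fst) `&` (chiO \o snd))%O; split.
  - apply: fuzzy_open_meet.
      by apply: fst_lcontinuous; exact: fuzzy_open_indicator.
    by apply: snd_lcontinuous; exact: fuzzy_open_indicator.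
  - rewrite lt_pmeet /= /chiT /chiO !indicator1//.
    by rewrite (lt_le_trans tw (i01_le1 _)).
  - move=> [W' y']; apply: le_indicator.
    by rewrite lt_pmeet => /andP[/indicatorP TW' /indicatorP]; exact: TOW.
have [k kE] := slice _ _ ow.
exists [set W | 0%:i01 < a (k W)]%O; split.
- exact: (lmapP k oa).
- rewrite /= (_ : k V = k0 tt)//; apply: points => y.
  by rewrite kE k0E.
- move=> W aW; rewrite opens_leE => y by_.
  apply: (@indicatorP _ _ _ 0%:i01); rewrite -/(w (W, y)) -kE.
  by apply: lt_le_trans (ab _ _); rewrite lt_min; apply/andP.
Qed.

Definition lowen_function_space (T : lowenSpace R) : lowenSpace R :=
  gen_lowen [set Gam : lmap oX T -> I | exists U v,
    fuzzy_open T v /\ Gam = fun g => scott_core U (v \o g)].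

Theorem core_compact_LFTS_exponentiable :
  core_compact X -> exponentiable (LFTS_products R) oX.
Proof.
move=> ccX; apply: universal_exponentiable => T.
have evC : @lcontinuous _ (lprod (lowen_function_space T) oX) T
    (fun p => p.1 p.2).
  move=> v ov; apply: fuzzy_open_local => -[g x] t tv.
  have [U [Ux tU]] := scott_core_approx ccX (lmapP g ov) tv.
  exists (((fun g : lmap oX T => scott_core U (v \o g)) \o fst) `&`
          (indicator (val U) \o snd))%O; split.
  - apply: fuzzy_open_meet.
      apply: (@fst_lcontinuous _ (lowen_function_space T)).
      by apply: sub_gen_smallest; exists U, v.
    by apply: snd_lcontinuous; exact: fuzzy_open_indicator.
  - by rewrite lt_pmeet /= tU indicator1//; apply: lt_le_trans tU (i01_le1 _).
  - move=> [g' y]; apply: le_of_lt => s.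
    rewrite lt_pmeet => /andP[/= sU /indicatorP Uy].
    exact: ltW (lt_le_trans sU (scott_core_le _ Uy)).
exists (lowen_function_space T), (LMap evC) => Z h.
have sectionC (z : Z) : @lcontinuous _ oX T (fun x => (h : lmap _ _) (z, x)).
  move=> v ov; apply: fuzzy_open_local => x t tv.
  have [a [b [oa ob ta tb ab]]] := lprod_rectangle (lmapP h ov) tv.
  exists (cst (a z) `&` b)%O; split=> [||y].
  - by apply: fuzzy_open_meet => //; exact: fuzzy_open_cst.
  - by rewrite lt_pmeet /= ta.
  - exact: ab.
have kC : @lcontinuous _ Z (lowen_function_space T)
    (fun z => LMap (sectionC z)).
  apply: gen_lowen_continuous => _ [U [v [ov ->]]].
  exact: (fuzzy_open_scott_core ccX U (lmapP h ov)).
exists (LMap kC); split; first by apply: lmapEP => -[z x].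
move=> k kh; apply: lmapEP => z; apply: lmapEP => x.
by have /(_ (z, x)) := LFTS_homE kh.
Qed.

End LFTSExponential.

End Fuzzy.

Theorem theorem6p3 (R : realType) (X : topologicalType) :
  [<-> exponentiable Top_products X;
       core_compact X;
       continuous_lattice (opens X);
       SKA (omega R X);
       exponentiable (LFTS_products R) (omega R X)].
Proof.
tfae.
- exact: Top_exponentiable_core_compact.
- exact: core_compact_continuous.
- by move=> /continuous_core_compact; exact: core_compact_SKA.
- by move=> /SKA_core_compact; exact: core_compact_LFTS_exponentiable.
- move=> /LFTS_exponentiable_core_compact.
  exact: core_compact_Top_exponentiable.
Qed.
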